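(* Let $\chi$ be a nonprincipal primitive Dirichlet character with conductor $f_\chi$, let $r$ be a positive integer and let $b\ge 0$ be real. For $\theta>0$ set $$G_{2,\chi}(\theta,b,r)=r\sum_{n=0}^\infty\chi(n)e^{-(n+b/r)^r\theta}.$$ Then for any nonnegative integer $N$, $$G_{2,\chi}(\theta,b,r)=-r\sum_{n=0}^{N}(-1)^n\frac{B_{rn+1,\bar\chi}\left(\frac br\right)}{(rn+1)\,n!}\,\theta^n+O(\theta^{N+1})\qquad\text{as }\theta\to0^+.$$
   Context: The principal character $\chi^0$ is the one with conductor $1$, i.e. $\chi^0(m)=1$ for all integers $m$; ''nonprincipal'' means $\chi\ne\chi^0$. A primitive character $\chi$ modulo $f_\chi$ is regarded as a function on $\mathbb Z$, periodic mod $f_\chi$ and zero on integers not coprime to $f_\chi$; $\bar\chi$ is its complex conjugate. For a primitive character $\chi$ modulo $f_\chi$, the generalized Bernoulli polynomials $B_{n,\chi}(x)$ are defined by (note the conjugate) $$\sum_{m=0}^{f_\chi-1}\frac{\bar\chi(m)\,t\,e^{(m+x)t}}{e^{f_\chi t}-1}=\sum_{n=0}^\infty B_{n,\chi}(x)\frac{t^n}{n!}\qquad(|t|<2\pi/f_\chi).$$ Thus $B_{n,\bar\chi}(x)$ is given by the same generating function with $\chi(m)$ in place of $\bar\chi(m)$. The implied constant in $O(\theta^{N+1})$ may depend on $N,\chi,b,r$. *)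

(* Defs.v *)
From Stdlib Require Import Reals ZArith Lia Lra.
From Coquelicot Require Import Coquelicot.
Open Scope R_scope.

(** * Dirichlet characters, as functions on [Z] *)

Definition is_dirichlet_character (q : nat) (chi : Z -> C) : Prop :=
  (0 < q)%nat /\
  (forall m n : Z, chi (m * n)%Z = Cmult (chi m) (chi n)) /\
  (forall m : Z, chi (m + Z.of_nat q)%Z = chi m) /\
  (forall m : Z, chi m <> RtoC 0 <-> Z.gcd m (Z.of_nat q) = 1%Z).

(** [psi], a character modulo a divisor of [q], induces [chi] modulo [q]. *)
Definition induces (psi : Z -> C) (q : nat) (chi : Z -> C) : Prop :=
  forall m : Z, Z.gcd m (Z.of_nat q) = 1%Z -> chi m = psi m.

(** Primitive modulo [f]: in this case the conductor of [chi] is [f]. *)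
Definition is_primitive_character (f : nat) (chi : Z -> C) : Prop :=
  is_dirichlet_character f chi /\
  forall (d : nat) (psi : Z -> C),
    Nat.divide d f -> is_dirichlet_character d psi -> induces psi f chi ->
    d = f.

Definition principal_character : Z -> C := fun _ => RtoC 1.

Definition conj_character (chi : Z -> C) : Z -> C := fun m => Cconj (chi m).

(** * Complex exponential and complex series *)

Definition Cexp (z : C) : C :=
  (exp (Re z) * cos (Im z), exp (Re z) * sin (Im z)).

(** The sum of a complex series, with the convention of [Series]: it is
    meaningful when the series converges. *)
Definition CSeries (a : nat -> C) : C :=
  (Series (fun n => Re (a n)), Series (fun n => Im (a n))).

(** * Generalized Bernoulli polynomials *)

(** The generating function of the [B_{n,chi}(x)], for [t <> 0]; the singularity
    at [t = 0] is removable.  Note the conjugate of [chi]. *)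
Definition bernoulli_gen_fun (f : nat) (chi : Z -> C) (x t : C) : C :=
  sum_n (fun m : nat =>
    Cdiv (Cconj (chi (Z.of_nat m)) * t * Cexp ((RtoC (INR m) + x) * t))%C
         (Cexp (RtoC (INR f) * t) - RtoC 1)%C) (f - 1).

(** [B n x] is [B_{n,chi}(x)] for all [n] and [x].  The values [B n x] are
    uniquely determined, being the coefficients of a power series in [t]. *)
Definition is_gen_bernoulli (f : nat) (chi : Z -> C) (B : nat -> C -> C) : Prop :=
  forall x t : C, t <> RtoC 0 -> Cmod t < 2 * PI / INR f ->
    is_series (K := C_AbsRing) (V := C_NormedModule)
      (fun n : nat => (B n x * (Cpow t n / RtoC (INR (fact n))))%C)
      (bernoulli_gen_fun f chi x t).

(** * The function [G_{2,chi}] *)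

Definition G2_term (chi : Z -> C) (theta b : R) (r : nat) (n : nat) : C :=
  (chi (Z.of_nat n) * RtoC (exp (- (INR n + b / INR r) ^ r * theta)))%C.

Definition G2 (chi : Z -> C) (theta b : R) (r : nat) : C :=
  (RtoC (INR r) * CSeries (G2_term chi theta b r))%C.

Lemma CSeries_correct (a : nat -> C) :
  ex_series (fun n => Cmod (a n)) ->
  is_series (K := C_AbsRing) (V := C_NormedModule) a (CSeries a).
Proof.
intros H.
assert (H1 : ex_series (fun n => Re (a n))).
{ apply (ex_series_le (K := R_AbsRing) (V := R_CompleteNormedModule))
    with (2 := H); intros n.
  exact (Rle_trans _ _ _ (Rmax_l _ (Rabs (Im (a n)))) (Rmax_Cmod (a n))). }
assert (H2 : ex_series (fun n => Im (a n))).
{ apply (ex_series_le (K := R_AbsRing) (V := R_CompleteNormedModule))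
    with (2 := H); intros n.
  exact (Rle_trans _ _ _ (Rmax_r (Rabs (Re (a n))) _) (Rmax_Cmod (a n))). }
apply Series_correct in H1. apply Series_correct in H2.
assert (E : forall n, sum_n a n =
  (sum_n (fun k => Re (a k)) n, sum_n (fun k => Im (a k)) n)).
{ induction n as [|n IH].
  - rewrite !sum_O. apply surjective_pairing.
  - rewrite !sum_Sn, IH. reflexivity. }
apply filterlim_locally. intros eps.
generalize (filter_and _ _ (proj1 (filterlim_locally _ _) H1 eps)
  (proj1 (filterlim_locally _ _) H2 eps)).
apply filter_imp. intros n [K1 K2]. rewrite E. split; assumption.
Qed.

Lemma dirichlet_character_bounded (q : nat) (chi : Z -> C) :
  is_dirichlet_character q chi ->
  exists M : R, forall n : nat, Cmod (chi (Z.of_nat n)) <= M.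
Proof.
intros (Hq & _ & Hper & _).
assert (Hk : forall (k : nat) (m : Z),
  chi (m + Z.of_nat q * Z.of_nat k)%Z = chi m).
{ induction k as [|k IH]; intros m.
  - f_equal. lia.
  - rewrite <- (IH m), <- (Hper (m + Z.of_nat q * Z.of_nat k)%Z).
    f_equal. lia. }
assert (HM : forall j : nat, exists M : R,
  forall n : nat, (n < j)%nat -> Cmod (chi (Z.of_nat n)) <= M).
{ induction j as [|j [M IH]].
  - exists 0. intros n Hn. lia.
  - exists (Rmax M (Cmod (chi (Z.of_nat j)))). intros n Hn.
    destruct (Nat.eq_dec n j) as [->|Hne].
    + apply Rmax_r.
    + apply Rle_trans with (2 := Rmax_l _ _). apply IH. lia. }
destruct (HM q) as [M HMq]. exists M. intros n.
rewrite (Nat.div_mod n q) by lia.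
rewrite Nat.add_comm, Nat2Z.inj_add, Nat2Z.inj_mul, Hk.
apply HMq. apply Nat.mod_upper_bound. lia.
Qed.

Lemma G2_is_series (q : nat) (chi : Z -> C) (theta b : R) (r : nat) :
  is_dirichlet_character q chi -> 0 < theta -> 0 <= b -> (0 < r)%nat ->
  is_series (K := C_AbsRing) (V := C_NormedModule)
    (G2_term chi theta b r) (CSeries (G2_term chi theta b r)).
Proof.
intros Hchi Ht Hb Hr. apply CSeries_correct.
destruct (dirichlet_character_bounded q chi Hchi) as [M HM].
assert (HM0 : 0 <= M).
{ apply Rle_trans with (2 := HM 0%nat). apply Cmod_ge_0. }
apply (ex_series_le (K := R_AbsRing) (V := R_CompleteNormedModule))
  with (b := fun n => scal M (exp (- theta) ^ n)).
2:{ apply (ex_series_scal (K := R_AbsRing) (V := R_NormedModule)).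
    apply ex_series_geom. rewrite Rabs_pos_eq by (left; apply exp_pos).
    rewrite <- exp_0. apply exp_increasing. lra. }
intros n. unfold norm, scal; simpl. unfold abs, mult; simpl.
rewrite Rabs_pos_eq by apply Cmod_ge_0.
unfold G2_term. rewrite Cmod_mult, Cmod_R.
rewrite Rabs_pos_eq by (left; apply exp_pos).
apply Rmult_le_compat; [apply Cmod_ge_0 | left; apply exp_pos | apply HM |].
replace (exp (- theta) ^ n) with (exp (- INR n * theta)).
2:{ clear. induction n as [|n IH].
    - simpl. rewrite <- exp_0. f_equal. ring.
    - simpl pow. rewrite <- IH, <- exp_plus, S_INR. f_equal. ring. }
assert (Hbr : 0 <= b / INR r).
{ apply Rmult_le_pos; [assumption|]. left. apply Rinv_0_lt_compat.
  apply lt_0_INR. assumption. }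
assert (Hn : INR n <= (INR n + b / INR r) ^ r).
{ destruct n as [|n].
  - simpl INR. apply pow_le. lra.
  - assert (H1 : 1 <= INR (S n)) by (rewrite S_INR; generalize (pos_INR n); lra).
    apply Rle_trans with ((INR (S n) + b / INR r) ^ 1); [rewrite pow_1; lra|].
    apply Rle_pow; [lra | lia]. }
assert (Hle : - (INR n + b / INR r) ^ r * theta <= - INR n * theta) by nra.
destruct Hle as [Hlt|Heq].
- left. apply exp_increasing. exact Hlt.
- right. rewrite Heq. reflexivity.
Qed.

(* Main.v *)
Require Import Defs.
From Stdlib Require Import Reals ZArith Lia Lra Permutation List FunctionalExtensionality Classical.
From Coquelicot Require Import Coquelicot.
Open Scope R_scope.

(** Put [theta = d^r], [x = b/r] and [g y = exp (- y^r)], so that [G2] is [r] times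
    the sum of [chi n * g ((n + x) * d)].  Grouping by periods, this is the sum of
    [F (q f d)] over [q >= 0], where [F y = sum_(m < f) chi m * g (y + (m + x) d)].
    With [D = d/dy], formally [F = sum_m chi m * e^((m + x) d D) g], and the generating
    function of the Bernoulli polynomials gives [F y = H (y + f d) - H y] for
    [H = sum_k B_(k+1)(x) / (k+1)! * d^k * D^k g]; no antiderivative of [g] occurs because
    [B_0 = 0], the values of a nonprincipal primitive [chi] having zero sum over a period.
    Truncating [H] at order [L], Taylor's formula makes this an identity up to
    [O (d^(L+1) * e^(-y/2))], so the sum telescopes to [- H 0 + O (d^L)], and [H 0] is read
    off from the Taylor coefficients of [g] at [0]. *)

(** * Functions with exponentially decaying derivatives, and their Taylor expansion *)

Definition decaying_tower (g : nat -> R -> R) : Prop :=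
  (forall j y, is_derive (g j) y (g (S j) y)) /\
  (forall j, exists M, forall y, 0 <= y -> Rabs (g j y) <= M * exp (- (y / 2))).

Lemma tower_is_derive_n (g : nat -> R -> R) (j n : nat) (y : R) :
  decaying_tower g -> is_derive_n (g j) n y (g (j + n)%nat y).
Proof.
intros [D _]. revert y. induction n as [|n IH]; intros y; simpl.
- now rewrite Nat.add_0_r.
- apply is_derive_ext with (g (j + n)%nat).
  + intros t. symmetry. exact (is_derive_n_unique _ _ _ _ (IH t)).
  + rewrite <- plus_n_Sm. apply D.
Qed.

(** The Lagrange remainder is a derivative at some [z >= y], where the decay bound is at least as
    good as at [y]. Hence one constant serves all [d] and [y]. *)
Lemma tower_taylor (g : nat -> R -> R) (j n : nat) (s : R) :
  decaying_tower g -> 0 <= s ->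
  exists M, forall d y, 0 < d -> 0 <= y ->
    Rabs (g j (y + s * d) -
      sum_f_R0 (fun i => (s * d) ^ i / INR (fact i) * g (j + i)%nat y) n)
    <= M * d ^ S n * exp (- (y / 2)).
Proof.
intros Hg Hs. destruct (proj2 Hg (j + S n)%nat) as [M HM].
exists (s ^ S n / INR (fact (S n)) * M). intros d y Hd Hy.
assert (HM0 : 0 <= M).
{ specialize (HM 0 (Rle_refl 0)). rewrite Rdiv_0_l, Ropp_0, exp_0 in HM.
  generalize (Rabs_pos (g (j + S n)%nat 0)). lra. }
assert (Hsd : 0 <= s * d) by (apply Rmult_le_pos; lra).
assert (Hexp : exists z, y <= z /\
  g j (y + s * d) = sum_f_R0 (fun i => (s * d) ^ i / INR (fact i) * g (j + i)%nat y) n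
    + (s * d) ^ S n / INR (fact (S n)) * g (j + S n)%nat z).
(* [Taylor_Lagrange] works on a nondegenerate interval. If [s * d = 0], only the term [i = 0]
   survives, because [0 ^ 0 = 1]. *)
{ destruct Hsd as [Hsd | E].
  - destruct (Taylor_Lagrange (g j) n y (y + s * d)) as (z & Hz & E).
    + lra.
    + intros t _ k _. destruct k as [|k]; [exact I|].
      exists (g (j + S k)%nat t). exact (tower_is_derive_n g j (S k) t Hg).
    + exists z. split; [lra|]. rewrite E.
      replace (y + s * d - y) with (s * d) by ring. f_equal.
      * apply sum_eq. intros i _. f_equal.
        exact (is_derive_n_unique _ _ _ _ (tower_is_derive_n g j i y Hg)).
      * f_equal. exact (is_derive_n_unique _ _ _ _ (tower_is_derive_n g j (S n) z Hg)).
  - exists y. split; [lra|]. rewrite <- E, Rplus_0_r.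
    rewrite pow_i by lia. rewrite Rdiv_0_l, Rmult_0_l, Rplus_0_r.
    destruct n as [|n]; [simpl; rewrite Nat.add_0_r; field|].
    rewrite decomp_sum by lia.
    rewrite (sum_eq _ (fun _ => 0)).
    + rewrite sum_cte. simpl. rewrite Nat.add_0_r. field.
    + intros i _. rewrite pow_i by lia. rewrite Rdiv_0_l. ring. }
destruct Hexp as (z & Hz & E). rewrite E.
match goal with |- Rabs (?a + ?b - ?a) <= _ => replace (a + b - a) with b by ring end.
rewrite Rabs_mult.
assert (HF := INR_fact_lt_0 (S n)).
assert (Hc : 0 <= (s * d) ^ S n / INR (fact (S n))).
{ apply Rdiv_le_0_compat; [apply pow_le; lra | assumption]. }
rewrite (Rabs_pos_eq _ Hc).
replace (s ^ S n / INR (fact (S n)) * M * d ^ S n * exp (- (y / 2))) with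
  ((s * d) ^ S n / INR (fact (S n)) * (M * exp (- (y / 2)))).
2:{ rewrite Rpow_mult_distr. unfold Rdiv. ring. }
apply Rmult_le_compat_l; [assumption|].
eapply Rle_trans; [apply HM; lra|]. apply Rmult_le_compat_l; [assumption|].
destruct (Rle_lt_or_eq_dec _ _ Hz) as [H|H].
- left. apply exp_increasing. lra.
- rewrite H. lra.
Qed.

(** * Finite double sums and uniform bounds for finite sums *)

(** Both sides run over the triangle [k + i <= L], the right one along the diagonals [k + i = n].
    Passing from [L] to [S L] adds one diagonal. *)
Lemma sum_triangle_reindex (a : nat -> nat -> R) (L : nat) :
  sum_f_R0 (fun k => sum_f_R0 (fun i => a k i) (L - k)) L =
  sum_f_R0 (fun n => sum_f_R0 (fun k => a k (n - k)%nat) n) L.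
Proof.
induction L as [|L IH]; [reflexivity|].
rewrite tech5, (tech5 (fun n => sum_f_R0 _ n)), <- IH.
rewrite (tech5 (fun k => a k (S L - k)%nat)).
rewrite Nat.sub_diag. simpl (sum_f_R0 _ 0).
rewrite <- Rplus_assoc. f_equal. rewrite <- plus_sum. apply sum_eq.
intros k Hk. replace (S L - k)%nat with (S (L - k)) by lia. apply tech5.
Qed.

Lemma sum_exchange (a : nat -> nat -> R) (p q : nat) :
  sum_f_R0 (fun i => sum_f_R0 (a i) q) p = sum_f_R0 (fun j => sum_f_R0 (fun i => a i j) p) q.
Proof.
induction p as [|p IH]; [reflexivity|].
rewrite tech5, IH, <- plus_sum. apply sum_eq. intros j _. now rewrite tech5.
Qed.

(** Combines finitely many estimates into one whose constant is still independent of [z]. The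
    parameter [z] will be a pair [(d, y)]. *)
Lemma finite_sum_bound (Z : Type) (P : Z -> Prop) (D : Z -> R) (c : nat -> R)
  (u : nat -> Z -> R) (n : nat) :
  (forall k, (k <= n)%nat -> exists M, forall z, P z -> Rabs (u k z) <= M * D z) ->
  exists M, forall z, P z -> Rabs (sum_f_R0 (fun k => c k * u k z) n) <= M * D z.
Proof.
intros Hu. induction n as [|n IH].
- destruct (Hu 0%nat (Nat.le_refl _)) as [M HM]. exists (Rabs (c 0%nat) * M).
  intros z Hz. simpl. rewrite Rabs_mult, Rmult_assoc.
  apply Rmult_le_compat_l; [apply Rabs_pos | now apply HM].
- destruct IH as [M1 H1]; [intros; apply Hu; lia|].
  destruct (Hu (S n) (Nat.le_refl _)) as [M HM].
  exists (M1 + Rabs (c (S n)) * M). intros z Hz. rewrite tech5.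
  eapply Rle_trans; [apply Rabs_triang|]. rewrite Rmult_plus_distr_r.
  apply Rplus_le_compat; [now apply H1|].
  rewrite Rabs_mult, Rmult_assoc.
  apply Rmult_le_compat_l; [apply Rabs_pos | now apply HM].
Qed.

(** * Telescoping over the periods *)

Definition expm1_coef (w : R) (i : nat) : R :=
  match i with O => 0 | S _ => w ^ i / INR (fact i) end.

(** The function [H] of the overview truncated at order [L], where [a k] stands for
    [B_(k+1)(x) / (k+1)!]. *)
Definition tower_sum (g : nat -> R -> R) (a : nat -> R) (L : nat) (d y : R) : R :=
  sum_f_R0 (fun k => a k * (d ^ k * g k y)) L.

(** The last hypothesis compares coefficients in [sum_m c_m e^((m+x)t) = (e^(wt) - 1) * sum_k a_k t^k];
    it is used with [t] replaced by [d * D], [D] being the shift of the tower [g]. *)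
Lemma period_step (g : nat -> R -> R) (c a : nat -> R) (p L : nat) (x w : R) :
  decaying_tower g -> 0 <= x -> 0 <= w ->
  (forall n, sum_f_R0 (fun m => c m * ((INR m + x) ^ n / INR (fact n))) p =
             sum_f_R0 (fun k => a k * expm1_coef w (n - k)) n) ->
  exists M, forall d y, 0 < d -> 0 <= y ->
    Rabs (sum_f_R0 (fun m => c m * g 0%nat (y + (INR m + x) * d)) p
          - (tower_sum g a L d (y + w * d) - tower_sum g a L d y))
    <= M * (d ^ S L * exp (- (y / 2))).
Proof.
intros Hg Hx Hw Hrel.
set (P := fun z : R * R => 0 < fst z /\ 0 <= snd z).
set (D := fun z : R * R => fst z ^ S L * exp (- (snd z / 2))).
set (taylor := fun j n s d y =>
  sum_f_R0 (fun i => (s * d) ^ i / INR (fact i) * g (j + i)%nat y) n).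
destruct (finite_sum_bound (R * R) P D c
  (fun m z => g 0%nat (snd z + (INR m + x) * fst z)
              - taylor 0%nat L (INR m + x) (fst z) (snd z)) p) as [M1 H1].
{ intros m _.
  destruct (tower_taylor g 0 L (INR m + x) Hg) as [M HM].
  { generalize (pos_INR m). lra. }
  exists M. intros [d y] [Hd Hy]. unfold D. simpl fst in *. simpl snd in *.
  rewrite <- Rmult_assoc. apply HM; assumption. }
(* The term of index [k] already carries [d ^ k], so expanding [g k] to order [L - k] is enough for
   a remainder of order [d ^ S L]. *)
destruct (finite_sum_bound (R * R) P D a
  (fun k z => fst z ^ k * (g k (snd z + w * fst z)
              - taylor k (L - k)%nat w (fst z) (snd z))) L) as [M2 H2].
{ intros k Hk. destruct (tower_taylor g k (L - k) w Hg Hw) as [M HM].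
  exists M. intros [d y] [Hd Hy]. unfold D. simpl fst in *. simpl snd in *.
  rewrite Rabs_mult, Rabs_pos_eq by (apply pow_le; lra).
  replace (d ^ S L) with (d ^ k * d ^ S (L - k)) by (rewrite <- pow_add; f_equal; lia).
  replace (M * (d ^ k * d ^ S (L - k) * exp (- (y / 2)))) with
    (d ^ k * (M * d ^ S (L - k) * exp (- (y / 2)))) by ring.
  apply Rmult_le_compat_l; [apply pow_le; lra | apply HM; assumption]. }
exists (M1 + M2). intros d y Hd Hy.
assert (HP : P (d, y)) by (split; assumption).
specialize (H1 _ HP). specialize (H2 _ HP). unfold D in H1, H2. simpl fst in *. simpl snd in *.
rewrite Rmult_plus_distr_r.
(* The Taylor polynomials of the two sides agree exactly: in both, the coefficient of
   [d ^ n * g n y] is the one given by [Hrel]. Only the two remainders are left to bound. *)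
assert (E : sum_f_R0 (fun m => c m * taylor 0%nat L (INR m + x) d y) p =
  sum_f_R0 (fun k => a k * (d ^ k * (taylor k (L - k)%nat w d y - g k y))) L).
{ transitivity (sum_f_R0 (fun n => sum_f_R0 (fun k => a k * expm1_coef w (n - k)) n
    * (d ^ n * g n y)) L).
  - unfold taylor.
    rewrite (sum_eq _ (fun m => sum_f_R0 (fun i =>
      c m * ((INR m + x) ^ i / INR (fact i)) * (d ^ i * g i y)) L)).
    2:{ intros m _. rewrite scal_sum. apply sum_eq. intros i _.
        rewrite Rpow_mult_distr. simpl (0 + i)%nat. unfold Rdiv. ring. }
    rewrite sum_exchange. apply sum_eq. intros n _.
    rewrite <- Hrel, (Rmult_comm (sum_f_R0 _ _)), scal_sum. reflexivity.
  - rewrite (sum_eq _ (fun n => sum_f_R0 (fun k =>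
      a k * expm1_coef w (n - k) * (d ^ (k + (n - k)) * g (k + (n - k))%nat y)) n)).
    2:{ intros n _. rewrite (Rmult_comm (sum_f_R0 _ _)), scal_sum. apply sum_eq. intros k Hk.
        now replace (k + (n - k))%nat with n by lia. }
    rewrite <- (sum_triangle_reindex
      (fun k i => a k * expm1_coef w i * (d ^ (k + i) * g (k + i)%nat y))).
    apply sum_eq. intros k _. unfold taylor.
    transitivity (a k * d ^ k *
      sum_f_R0 (fun i => expm1_coef w i * (d ^ i * g (k + i)%nat y)) (L - k)).
    + rewrite scal_sum. apply sum_eq. intros i _. rewrite pow_add. ring.
    + rewrite Rmult_assoc. do 2 f_equal.
      (* Subtracting [g k y] removes the term [i = 0] of the Taylor polynomial, in agreement with
         [expm1_coef w 0 = 0]. *)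
      destruct (L - k)%nat as [|n].
      * simpl. rewrite Nat.add_0_r. field.
      * rewrite decomp_sum by lia.
        rewrite (decomp_sum (fun i => (w * d) ^ i / _ * _)) by lia. simpl pred.
        match goal with |- ?A + ?S1 = ?B + ?S2 - ?G =>
          assert (E1 : S1 = S2); [|rewrite E1, Nat.add_0_r; simpl; field] end.
        apply sum_eq. intros i _. rewrite Rpow_mult_distr.
        unfold expm1_coef, Rdiv. ring. }
match type of H1 with Rabs ?X1 <= _ => match type of H2 with Rabs ?X2 <= _ =>
  match goal with |- Rabs ?X <= _ => replace X with (X1 + - X2) end end end.
{ eapply Rle_trans; [apply Rabs_triang|]. rewrite Rabs_Ropp.
  apply Rplus_le_compat; assumption. }
rewrite (sum_eq (fun m => c m * (_ - _)) (fun m => c m * g 0%nat (y + (INR m + x) * d)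
  - c m * taylor 0%nat L (INR m + x) d y)) by (intros; ring).
rewrite (sum_eq (fun k => a k * (d ^ k * (g k (y + w * d) - _)))
  (fun k => a k * (d ^ k * g k (y + w * d)) - a k * (d ^ k * g k y)
    - a k * (d ^ k * (taylor k (L - k)%nat w d y - g k y)))) by (intros; ring).
rewrite !minus_sum, E. unfold tower_sum. ring.
Qed.

(** Makes the far end of the telescoping sum vanish in the limit. The powers [d ^ k] are at most 1
    since [d < 1]. *)
Lemma tower_sum_bound (g : nat -> R -> R) (a : nat -> R) (L : nat) :
  decaying_tower g ->
  exists M, forall d y, 0 < d < 1 -> 0 <= y ->
    Rabs (tower_sum g a L d y) <= M * exp (- (y / 2)).
Proof.
intros Hg.
destruct (finite_sum_bound (R * R) (fun z => 0 < fst z < 1 /\ 0 <= snd z)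
  (fun z => exp (- (snd z / 2))) a (fun k z => fst z ^ k * g k (snd z)) L) as [M HM].
{ intros k _. destruct (proj2 Hg k) as [M HM]. exists M.
  intros [d y] [Hd Hy]. simpl fst in *; simpl snd in *.
  rewrite Rabs_mult, Rabs_pos_eq by (apply pow_le; lra).
  rewrite <- (Rmult_1_l (M * _)).
  apply Rmult_le_compat; [apply pow_le; lra | apply Rabs_pos | | now apply HM].
  rewrite <- (pow1 k). apply pow_incr. lra. }
exists M. intros d y Hd Hy. apply (HM (d, y)). split; assumption.
Qed.

Lemma exp_mult_INR (u : R) (n : nat) : exp (INR n * u) = exp u ^ n.
Proof.
induction n as [|n IH]; [simpl; now rewrite Rmult_0_l, exp_0|].
rewrite S_INR, Rmult_plus_distr_r, exp_plus, IH. simpl. ring_simplify (1 * u). ring.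
Qed.

(** Multiplying [1 + u <= exp u] by [exp (- u)] gives both parts. The second bounds [1 - exp (- u)]
    from below, which controls the sum of a geometric series of ratio [exp (- u)]. *)
Lemma exp_neg_bounds (u : R) : 0 < u -> 0 < exp (- u) < 1 /\ u <= (1 + u) * (1 - exp (- u)).
Proof.
intros Hu. assert (H := exp_ineq1 u ltac:(lra)). assert (H1 := exp_pos (- u)).
assert (E : exp u * exp (- u) = 1) by (rewrite <- exp_plus, Rplus_opp_r; apply exp_0).
split; nra.
Qed.

(** Each period contributes an error of order [d ^ S L], damped by [rho ^ q] in the period of index
    [q]. The geometric series sums to [O(1/d)], so one power of [d] is lost. *)
Lemma periodic_series_asymptotics (g : nat -> R -> R) (c a : nat -> R) (p L : nat) (x : R) :
  decaying_tower g -> 0 <= x ->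
  (forall n, c (n + S p)%nat = c n) ->
  (exists C, forall n, Rabs (c n) <= C) ->
  (forall n, sum_f_R0 (fun m => c m * ((INR m + x) ^ n / INR (fact n))) p =
             sum_f_R0 (fun k => a k * expm1_coef (INR (S p)) (n - k)) n) ->
  exists M, forall d, 0 < d < 1 ->
    Rabs (Series (fun n => c n * g 0%nat ((INR n + x) * d)) + tower_sum g a L d 0)
    <= M * d ^ L.
Proof.
intros Hg Hx Hper [C HC] Hrel.
set (w := INR (S p)) in *.
assert (Hw : 1 <= w) by (unfold w; rewrite S_INR; generalize (pos_INR p); lra).
destruct (period_step g c a p L x w Hg Hx ltac:(lra) Hrel) as [M HM].
destruct (tower_sum_bound g a L Hg) as [M' HM'].
destruct (proj2 Hg 0%nat) as [M0 HM0].
exists (3 * M). intros d Hd.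
set (u := fun n => c n * g 0%nat ((INR n + x) * d)).
set (rho := exp (- (w * d / 2))).
destruct (exp_neg_bounds (w * d / 2)) as [Hrho Hrho1]; [nra|]. fold rho in Hrho, Hrho1.
assert (HMpos : 0 <= M).
{ specialize (HM d 0 (proj1 Hd) (Rle_refl 0)).
  assert (0 < d ^ S L * exp (- (0 / 2))).
  { apply Rmult_lt_0_compat; [apply pow_lt; lra | apply exp_pos]. }
  eapply Rle_trans in HM; [|apply Rabs_pos]. nra. }
assert (Hpow : forall Q, exp (- (INR Q * w * d / 2)) = rho ^ Q).
{ intros Q. unfold rho. rewrite <- exp_mult_INR. f_equal. unfold Rdiv. ring. }
(* Indices up to [p + Q * S p] make up exactly [S Q] full periods of length [S p]. *)
assert (Hblock : forall Q,
  Rabs (sum_f_R0 u (p + Q * S p)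
        - (tower_sum g a L d (INR (S Q) * w * d) - tower_sum g a L d 0))
  <= M * d ^ S L * sum_f_R0 (fun q => rho ^ q) Q).
{ induction Q as [|Q IH].
  - specialize (HM d 0 (proj1 Hd) (Rle_refl 0)).
    rewrite Rdiv_0_l, Ropp_0, exp_0, Rplus_0_l, Rmult_1_r in HM.
    simpl sum_f_R0 at 2. rewrite Rmult_1_r. simpl (0 * _)%nat.
    rewrite Nat.add_0_r. change (INR 1) with 1. rewrite Rmult_1_l.
    rewrite (sum_eq u (fun m => c m * g 0%nat (0 + (INR m + x) * d))); [exact HM|].
    intros m _. now rewrite Rplus_0_l.
  - set (y := INR (S Q) * w * d) in *.
    assert (Hy : 0 <= y).
    { unfold y. apply Rmult_le_pos; [|lra]. apply Rmult_le_pos; [apply pos_INR | lra]. }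
    specialize (HM d y (proj1 Hd) Hy).
    rewrite (tech2 u (p + Q * S p)) by lia.
    replace (p + S Q * S p - S (p + Q * S p))%nat with p by lia.
    rewrite (sum_eq (fun i => u (S (p + Q * S p) + i)%nat)
      (fun m => c m * g 0%nat (y + (INR m + x) * d))).
    2:{ intros m _. unfold u. f_equal.
        - replace (S (p + Q * S p) + m)%nat with (m + S Q * S p)%nat by lia.
          clear -Hper. induction (S Q) as [|k IH]; [f_equal; lia|].
          rewrite <- IH, <- (Hper (m + k * S p)%nat). f_equal. lia.
        - f_equal. replace (S (p + Q * S p) + m)%nat with (S Q * S p + m)%nat by lia.
          rewrite plus_INR, mult_INR. unfold y, w. ring. }
    rewrite tech5.
    replace (INR (S (S Q)) * w * d) with (y + w * d)
      by (unfold y; rewrite (S_INR (S Q)); ring).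
    rewrite (Hpow (S Q) : exp (- (y / 2)) = rho ^ S Q) in HM.
    match goal with |- Rabs (?A + ?B - (?T2 - ?T0)) <= _ =>
      match type of IH with context [?T1 - T0] =>
      replace (A + B - (T2 - T0)) with ((A - (T1 - T0)) + (B - (T2 - T1))) by ring end end.
    eapply Rle_trans; [apply Rabs_triang|].
    rewrite Rmult_plus_distr_l. apply Rplus_le_compat; [exact IH|].
    rewrite Rmult_assoc. exact HM. }
assert (Hgeom : forall Q, d * sum_f_R0 (fun q => rho ^ q) Q <= 3).
{ intros Q. rewrite tech3 by lra.
  assert (Hr : 0 <= rho ^ S Q) by (apply pow_le; lra).
  (* With [u = w * d / 2], [Hrho1] gives [w * d <= (2 + w * d) * (1 - rho)], and
     [2 + w * d <= 3 * w] because [w >= 1] and [d < 1]. This is the source of the factor 3. *)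
  assert (H3 : d <= 3 * (1 - rho)).
  { assert (w * d <= (2 + w * d) * (1 - rho)) by lra.
    assert (0 <= (w - 1) * (1 - rho)) by (apply Rmult_le_pos; lra).
    assert (0 <= w * (1 - rho) * (1 - d)).
    { apply Rmult_le_pos; [apply Rmult_le_pos|]; lra. }
    apply Rmult_le_reg_l with w; lra. }
  apply Rle_trans with (d * / (1 - rho)).
  - apply Rmult_le_compat_l; [lra|]. unfold Rdiv.
    rewrite <- (Rmult_1_l (/ (1 - rho))) at 2.
    apply Rmult_le_compat_r; [left; apply Rinv_0_lt_compat|]; lra.
  - apply Rmult_le_reg_r with (1 - rho); [lra|]. rewrite Rmult_assoc, Rinv_l by lra. lra. }
assert (Hfin : forall Q,
  Rabs (sum_f_R0 u (p + Q * S p) + tower_sum g a L d 0) <= 3 * M * d ^ L + M' * rho ^ S Q).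
{ intros Q. specialize (Hblock Q). specialize (Hgeom Q).
  assert (Hy : 0 <= INR (S Q) * w * d).
  { apply Rmult_le_pos; [|lra]. apply Rmult_le_pos; [apply pos_INR | lra]. }
  specialize (HM' d _ Hd Hy). rewrite Hpow in HM'.
  match type of Hblock with Rabs (?A - (?T1 - ?T0)) <= _ =>
    replace (A + T0) with ((A - (T1 - T0)) + T1) by ring end.
  eapply Rle_trans; [apply Rabs_triang|]. apply Rplus_le_compat; [|exact HM'].
  eapply Rle_trans; [exact Hblock|]. simpl pow.
  assert (HMd : 0 <= M * d ^ L) by (apply Rmult_le_pos; [lra | apply pow_le; lra]).
  nra. }
(* Convergence ensures that [Series u] is the limit of the partial sums; the comparison is with a
   geometric series of ratio [exp (- (d / 2))]. *)
assert (Hex : ex_series u).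
{ apply (ex_series_le (K := R_AbsRing) (V := R_CompleteNormedModule))
    with (b := fun n => scal (C * M0) (exp (- (d / 2)) ^ n)).
  2:{ apply (ex_series_scal (K := R_AbsRing) (V := R_NormedModule)).
      apply ex_series_geom. destruct (exp_neg_bounds (d / 2)); [lra|].
      rewrite Rabs_pos_eq; lra. }
  intros n. unfold norm, scal; simpl. unfold abs, mult; simpl. unfold u.
  assert (Hn := pos_INR n).
  rewrite Rabs_mult, Rmult_assoc.
  apply Rmult_le_compat; [apply Rabs_pos | apply Rabs_pos | apply HC |].
  eapply Rle_trans; [apply HM0; nra|].
  assert (0 <= M0).
  { specialize (HM0 0 (Rle_refl 0)). rewrite Rdiv_0_l, Ropp_0, exp_0 in HM0.
    generalize (Rabs_pos (g 0%nat 0)). lra. }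
  apply Rmult_le_compat_l; [assumption|]. rewrite <- exp_mult_INR.
  assert (Hle : - ((INR n + x) * d / 2) <= INR n * - (d / 2)) by nra.
  destruct Hle as [Hlt|Heq]; [left; now apply exp_increasing | right; now rewrite Heq]. }
apply Series_correct in Hex.
assert (Hlim : is_lim_seq (fun Q => sum_f_R0 u (p + Q * S p)) (Series u)).
{ apply is_lim_seq_ext with (fun Q => sum_n u (p + Q * S p)).
  { intros. apply sum_n_Reals. }
  apply (is_lim_seq_subseq (sum_n u)); [|exact Hex].
  apply eventually_subseq. intros. lia. }
(* For fixed [d], let [Q] tend to infinity in [Hfin]: the boundary term [M' * rho ^ S Q]
   disappears. *)
change (Rbar_le (Rabs (Series u + tower_sum g a L d 0)) (3 * M * d ^ L)).
apply is_lim_seq_le with (1 := Hfin).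
- apply (is_lim_seq_abs _ (Finite _)). apply is_lim_seq_plus'; [exact Hlim|].
  apply is_lim_seq_const.
- replace (Finite (3 * M * d ^ L)) with (Finite (3 * M * d ^ L + M' * 0))
    by (f_equal; ring).
  apply is_lim_seq_plus'; [apply is_lim_seq_const|].
  apply (is_lim_seq_scal_l _ M' (Finite 0)).
  apply (is_lim_seq_incr_1 (fun Q => rho ^ Q)). apply is_lim_seq_geom.
  rewrite Rabs_pos_eq; lra.
Qed.

(** * The function [exp (- y^r)]: decay of its derivatives and their values at 0 *)

(** Degrees and coefficients are irrelevant here: stability under differentiation and subexponential
    growth both follow by induction on the construction. *)
Inductive polynomial_fun : (R -> R) -> Prop :=
| polynomial_const a : polynomial_fun (fun _ => a)
| polynomial_id : polynomial_fun (fun y => y)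
| polynomial_plus P Q :
    polynomial_fun P -> polynomial_fun Q -> polynomial_fun (fun y => P y + Q y)
| polynomial_mult P Q :
    polynomial_fun P -> polynomial_fun Q -> polynomial_fun (fun y => P y * Q y).

Lemma polynomial_is_derive (P : R -> R) :
  polynomial_fun P -> exists P', polynomial_fun P' /\ forall y, is_derive P y (P' y).
Proof.
induction 1 as [a | | P Q HP (P' & HP' & DP) HQ (Q' & HQ' & DQ)
                | P Q HP (P' & HP' & DP) HQ (Q' & HQ' & DQ)].
- exists (fun _ => 0). split; [constructor|]. intros y. apply (is_derive_const a).
- exists (fun _ => 1). split; [constructor|]. intros y. apply (is_derive_id y).
- exists (fun y => P' y + Q' y). split; [now constructor|]. intros y.
  apply (is_derive_plus (V := R_NormedModule)); auto.
- exists (fun y => P' y * Q y + P y * Q' y). split; [constructor; now constructor|].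
  intros y. apply (is_derive_mult P Q); auto. intros; apply Rmult_comm.
Qed.

(** The rate [eps] is quantified inside the induction because a product spends [eps / 2] on each
    factor. *)
Lemma polynomial_bound (P : R -> R) :
  polynomial_fun P -> forall eps, 0 < eps ->
  exists M, forall y, 0 <= y -> Rabs (P y) <= M * exp (eps * y).
Proof.
induction 1 as [a | | P Q _ IHP _ IHQ | P Q _ IHP _ IHQ]; intros eps Heps.
- exists (Rabs a). intros y Hy. rewrite <- (Rmult_1_r (Rabs a)) at 1.
  apply Rmult_le_compat_l; [apply Rabs_pos|].
  generalize (exp_ineq1_le (eps * y)). nra.
- exists (/ eps). intros y Hy. rewrite Rabs_pos_eq by assumption.
  apply Rmult_le_reg_l with eps; [assumption|].
  rewrite <- Rmult_assoc, Rinv_r, Rmult_1_l by lra.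
  generalize (exp_ineq1_le (eps * y)). lra.
- destruct (IHP eps Heps) as [M1 H1]. destruct (IHQ eps Heps) as [M2 H2].
  exists (M1 + M2). intros y Hy. rewrite Rmult_plus_distr_r.
  eapply Rle_trans; [apply Rabs_triang|]. apply Rplus_le_compat; auto.
- destruct (IHP (eps / 2) ltac:(lra)) as [M1 H1].
  destruct (IHQ (eps / 2) ltac:(lra)) as [M2 H2].
  exists (M1 * M2). intros y Hy. rewrite Rabs_mult.
  replace (eps * y) with (eps / 2 * y + eps / 2 * y) by field.
  rewrite exp_plus.
  replace (M1 * M2 * _) with (M1 * exp (eps / 2 * y) * (M2 * exp (eps / 2 * y))) by ring.
  apply Rmult_le_compat; auto using Rabs_pos.
Qed.

Lemma polynomial_pow (n : nat) : polynomial_fun (fun y => y ^ n).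
Proof. induction n; simpl; repeat constructor; assumption. Qed.

Definition stretched_exp (r : nat) (y : R) : R := exp (- y ^ r).

Lemma polynomial_stretched_exp_is_derive (r : nat) (P : R -> R) :
  polynomial_fun P -> exists P', polynomial_fun P' /\
    forall y, is_derive (fun y => P y * stretched_exp r y) y (P' y * stretched_exp r y).
Proof.
intros HP. destruct (polynomial_is_derive P HP) as (P' & HP' & D).
exists (fun y => P' y + P y * (- INR r * y ^ pred r)). split.
- repeat constructor; auto using polynomial_pow.
- intros y. unfold stretched_exp. specialize (D y). auto_derive.
  + now exists (P' y).
  + replace (Derive (fun x => P x) y) with (P' y); [ring|]. symmetry. exact (is_derive_unique _ _ _ D).
Qed.

(** Every derivative is a polynomial times [exp (- y^r)]. For [y >= 0] the latter is at most
    [exp (1 - y)], and the polynomial costs at most a factor [exp (y / 2)] up to a constant. *)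
Lemma stretched_exp_tower (r : nat) :
  (0 < r)%nat -> decaying_tower (Derive_n (stretched_exp r)).
Proof.
intros Hr.
assert (H : forall j, exists P, polynomial_fun P /\
  forall y, Derive_n (stretched_exp r) j y = P y * stretched_exp r y).
{ induction j as [|j (P & HP & E)].
  - exists (fun _ => 1). split; [constructor|]. intros y. simpl. ring.
  - destruct (polynomial_stretched_exp_is_derive r P HP) as (P' & HP' & D).
    exists P'. split; [assumption|]. intros y. simpl.
    rewrite (Derive_ext _ _ _ E). apply is_derive_unique, D. }
split; intros j; destruct (H j) as (P & HP & E).
- intros y. apply Derive_correct.
  destruct (polynomial_stretched_exp_is_derive r P HP) as (P' & _ & D).
  exists (P' y * stretched_exp r y).
  apply is_derive_ext with (2 := D y). intros t. now rewrite E.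
- destruct (polynomial_bound P HP (1 / 2) ltac:(lra)) as [M HM].
  exists (M * exp 1). intros y Hy. rewrite E, Rabs_mult.
  unfold stretched_exp. rewrite (Rabs_pos_eq (exp _)) by (left; apply exp_pos).
  replace (M * exp 1 * exp (- (y / 2))) with (M * exp (1 / 2 * y) * exp (1 - y)).
  2:{ rewrite !Rmult_assoc, <- !exp_plus. do 2 f_equal. field. }
  apply Rmult_le_compat; [apply Rabs_pos | left; apply exp_pos | now apply HM |].
  (* For [y <= 1] the right side is nonnegative; for [y > 1], [y <= y ^ r] because [r] is
     positive. *)
  assert (Hle : - y ^ r <= 1 - y).
  { destruct (Rle_dec y 1) as [H1|H1].
    - generalize (pow_le y r Hy). lra.
    - assert (y ^ 1 <= y ^ r) by (apply Rle_pow; [lra | lia]). lra. }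
  destruct Hle as [Hlt|Heq]; [left; now apply exp_increasing | right; now rewrite Heq].
Qed.

(** Uniqueness of Taylor coefficients: letting [y] tend to 0 kills the constant term, then dividing
    by [y] lowers the degree. *)
Lemma small_polynomial_zero (L : nat) : forall (d : nat -> R) (M : R),
  (forall y, 0 < y < 1 -> Rabs (sum_f_R0 (fun k => d k * y ^ k) L) <= M * y ^ S L) ->
  forall k, (k <= L)%nat -> d k = 0.
Proof.
assert (Hsmall : forall a M, (forall y, 0 < y < 1 -> Rabs a <= M * y) -> a = 0).
{ intros a M H. destruct (Req_dec a 0) as [|Ha]; [assumption|exfalso].
  (* The value [y = 1/2] shows [M > 0]; then [y = Rabs a / (2 * M)] lies in the interval and yields
     [Rabs a <= Rabs a / 2]. *)
  assert (Ha' := Rabs_pos_lt a Ha). assert (H2 := H (1/2) ltac:(lra)).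
  assert (HM : 0 < M) by lra.
  assert (Hy : 0 < Rabs a / (2 * M)) by (apply Rdiv_lt_0_compat; lra).
  assert (Hy1 : Rabs a / (2 * M) < 1).
  { apply Rmult_lt_reg_r with (2 * M); [lra|].
    unfold Rdiv. rewrite Rmult_assoc, Rinv_l by lra. lra. }
  specialize (H _ (conj Hy Hy1)).
  replace (M * (Rabs a / (2 * M))) with (Rabs a / 2) in H by (field; lra). lra. }
induction L as [|L IH]; intros d M H.
- intros k Hk. replace k with 0%nat by lia. apply (Hsmall _ M). intros y Hy.
  specialize (H y Hy). simpl in H. now rewrite !Rmult_1_r in H.
- assert (E : forall y, sum_f_R0 (fun k => d k * y ^ k) (S L) =
    d 0%nat + y * sum_f_R0 (fun k => d (S k) * y ^ k) L).
  { intros y. rewrite decomp_sum by lia. simpl pred. rewrite scal_sum. f_equal.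
    - simpl. ring.
    - apply sum_eq. intros i _. simpl. ring. }
  assert (H0 : d 0%nat = 0).
  { apply (Hsmall _ (Rabs M + sum_f_R0 (fun k => Rabs (d (S k))) L)). intros y Hy.
    specialize (H y Hy). rewrite E in H.
    assert (Hpow : forall k, 0 <= y ^ k <= 1).
    { intros k. split; [apply pow_le; lra|]. rewrite <- (pow1 k). apply pow_incr. lra. }
    assert (HS : Rabs (sum_f_R0 (fun k => d (S k) * y ^ k) L)
                 <= sum_f_R0 (fun k => Rabs (d (S k))) L).
    { eapply Rle_trans; [apply Rsum_abs|]. apply sum_Rle. intros n _.
      rewrite Rabs_mult, (Rabs_pos_eq (y ^ n)) by apply Hpow.
      rewrite <- (Rmult_1_r (Rabs (d (S n)))) at 2.
      apply Rmult_le_compat_l; [apply Rabs_pos | apply Hpow]. }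
    assert (HMy : M * y ^ S (S L) <= Rabs M * y).
    { replace (M * y ^ S (S L)) with (M * y * y ^ S L) by (simpl; ring).
      assert (M * y <= Rabs M * y) by (apply Rmult_le_compat_r; [lra | apply Rle_abs]).
      assert (H1 := Hpow (S L)). assert (0 <= Rabs M * y).
      { apply Rmult_le_pos; [apply Rabs_pos | lra]. }
      apply Rle_trans with (Rabs M * y * y ^ S L); [apply Rmult_le_compat_r; lra|].
      rewrite <- (Rmult_1_r (Rabs M * y)) at 2. apply Rmult_le_compat_l; lra. }
    replace (d 0%nat) with ((d 0%nat + y * sum_f_R0 (fun k => d (S k) * y ^ k) L)
      + - (y * sum_f_R0 (fun k => d (S k) * y ^ k) L)) by ring.
    eapply Rle_trans; [apply Rabs_triang|].
    rewrite Rabs_Ropp, Rabs_mult, (Rabs_pos_eq y) by lra. nra. }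
  intros [|k] Hk; [assumption|].
  apply (IH (fun k => d (S k)) M); [|lia]. intros y Hy.
  specialize (H y Hy). rewrite E, H0, Rplus_0_l, Rabs_mult, Rabs_pos_eq in H by lra.
  apply Rmult_le_reg_l with y; [lra|]. simpl in *. lra.
Qed.

Lemma sum_multiples (h : nat -> R) (r N : nat) :
  (0 < r)%nat -> (forall k, ~ Nat.divide r k -> h k = 0) ->
  sum_f_R0 h (r * N) = sum_f_R0 (fun n => h (r * n)%nat) N.
Proof.
intros Hr Hz. induction N as [|N IH]; [cbn; now rewrite Nat.mul_0_r|].
rewrite tech5, <- IH.
assert (Hgap : forall j, (j < r)%nat -> sum_f_R0 h (r * N + j) = sum_f_R0 h (r * N)).
{ induction j as [|j IHj]; intros Hj; [now rewrite Nat.add_0_r|].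
  rewrite <- plus_n_Sm, tech5, IHj, Hz, Rplus_0_r; [reflexivity | | lia].
  intros [q Hq]. destruct (Nat.le_gt_cases q N) as [H|H];
    assert (H1 := Nat.mul_le_mono_r _ _ r H); lia. }
replace (r * S N)%nat with (S (r * N + pred r)) by lia.
rewrite tech5, Hgap by lia. reflexivity.
Qed.

(** The Lagrange remainder is [u ^ S n / (n+1)!] times [exp (- z)] up to sign, with [z > 0]; both
    extra factors are at most 1. *)
Lemma exp_neg_taylor (n : nat) (u : R) : 0 <= u ->
  Rabs (exp (- u) - sum_f_R0 (fun k => (-1) ^ k / INR (fact k) * u ^ k) n) <= u ^ S n.
Proof.
intros [Hu | <-].
2:{ rewrite pow_i by lia. rewrite Ropp_0, exp_0.
  replace (sum_f_R0 _ n) with 1; [rewrite Rminus_diag, Rabs_R0; lra|].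
  induction n as [|n IH]; [simpl; field|]. rewrite tech5, <- IH, pow_i by lia. ring. }
assert (D : forall k y, is_derive_n (fun v => exp (- v)) k y ((-1) ^ k * exp (- y))).
{ induction k as [|k IH]; intros y; [simpl; ring|].
  simpl. apply is_derive_ext with (fun v => (-1) ^ k * exp (- v)).
  - intros t. symmetry. exact (is_derive_n_unique _ _ _ _ (IH t)).
  - auto_derive; [exact I | ring]. }
destruct (Taylor_Lagrange (fun v => exp (- v)) n 0 u Hu) as (z & Hz & E).
{ intros t _ [|k] _; [exact I|]. eexists. exact (D (S k) t). }
rewrite E, Rminus_0_r. rewrite (is_derive_n_unique _ _ _ _ (D (S n) z)).
rewrite (sum_eq _ (fun k => (-1) ^ k / INR (fact k) * u ^ k)).
2:{ intros k _. rewrite (is_derive_n_unique _ _ _ _ (D k 0)), Ropp_0, exp_0.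
    field. apply INR_fact_neq_0. }
match goal with |- Rabs (?a + ?b - ?a) <= _ => replace (a + b - a) with b by ring end.
rewrite !Rabs_mult, pow_1_abs, Rmult_1_l.
assert (HF : 1 <= INR (fact (S n))) by (apply (le_INR 1), lt_O_fact).
assert (HU : 0 <= u ^ S n) by (apply pow_le; lra).
unfold Rdiv. rewrite Rabs_mult, (Rabs_pos_eq (u ^ S n)), (Rabs_pos_eq (exp _)), Rabs_pos_eq;
  [ | left; apply Rinv_0_lt_compat; lra | left; apply exp_pos | assumption].
destruct (exp_neg_bounds z ltac:(lra)) as [[H1 H2] _].
assert (H3 : 0 < / INR (fact (S n)) <= 1).
{ split; [apply Rinv_0_lt_compat; lra|]. rewrite <- Rinv_1. apply Rinv_le_contravar; lra. }
assert (u ^ S n * / INR (fact (S n)) <= u ^ S n) by nra.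
assert (0 <= u ^ S n * / INR (fact (S n))) by nra. nra.
Qed.

(** The Taylor polynomial at 0 and the exponential series in [- y^r] approximate the same function
    to the same order, so their coefficients coincide by [small_polynomial_zero]. *)
Lemma stretched_exp_derive_0 (r k : nat) : (0 < r)%nat ->
  Derive_n (stretched_exp r) k 0 =
  if Nat.eqb (k mod r) 0 then (-1) ^ (k / r) * INR (fact k) / INR (fact (k / r)) else 0.
Proof.
intros Hr.
set (tau := fun i => if Nat.eqb (i mod r) 0 then (-1) ^ (i / r) / INR (fact (i / r)) else 0).
set (dd := fun i => Derive_n (stretched_exp r) i 0 / INR (fact i) - tau i).
assert (H : dd k = 0).
{ destruct (tower_taylor _ 0 (r * k) 1 (stretched_exp_tower r Hr) Rle_0_1) as [M HM].
  apply (small_polynomial_zero (r * k) dd (M + 1)); [|nia].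
  intros y Hy. specialize (HM y 0 (proj1 Hy) (Rle_refl 0)).
  rewrite Rdiv_0_l, Ropp_0, exp_0, Rmult_1_r, Rplus_0_l, Rmult_1_l in HM.
  change (Derive_n (stretched_exp r) 0 y) with (exp (- y ^ r)) in HM.
  assert (HT := exp_neg_taylor k (y ^ r) ltac:(apply pow_le; lra)).
  rewrite (sum_eq _ (fun n => tau (r * n)%nat * y ^ (r * n))) in HT.
  2:{ intros n _. unfold tau.
      rewrite (Nat.mul_comm r n), Nat.Div0.mod_mul, Nat.div_mul by lia. simpl Nat.eqb. cbv iota.
      now rewrite (Nat.mul_comm n r), pow_mult. }
  rewrite <- (sum_multiples (fun i => tau i * y ^ i)) in HT; [|assumption|].
  2:{ intros i Hi. unfold tau. destruct (Nat.eqb_spec (i mod r) 0) as [E|E]; [|ring].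
      exfalso. apply Hi. now apply Nat.Lcm0.mod_divide. }
  (* The exponent [r * S k] is at least [S (r * k)], and [y < 1]. *)
  assert (HP : (y ^ r) ^ S k <= 1 * y ^ S (r * k)).
  { rewrite <- pow_mult. replace (r * S k)%nat with (S (r * k) + pred r)%nat by lia.
    rewrite pow_add, (Rmult_comm 1). apply Rmult_le_compat_l; [apply pow_le; lra|].
    rewrite <- (pow1 (pred r)). apply pow_incr. lra. }
  rewrite Rmult_plus_distr_r.
  eapply Rle_trans; [|apply Rplus_le_compat; [exact HM | eapply Rle_trans; [exact HT | exact HP]]].
  rewrite <- (Rabs_Ropp (_ - sum_f_R0 (fun i => y ^ i / _ * _) _)).
  eapply Rle_trans; [|apply Rabs_triang]. right. f_equal.
  match goal with |- _ = - (_ - ?A) + (_ - ?B) => transitivity (A - B); [|ring] end.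
  rewrite <- minus_sum. apply sum_eq. intros i _. unfold dd. simpl (0 + i)%nat.
  unfold Rdiv. ring. }
unfold dd, tau in H. assert (HF := INR_fact_neq_0 k).
replace (Derive_n (stretched_exp r) k 0) with
  (Derive_n (stretched_exp r) k 0 / INR (fact k) * INR (fact k)) by (field; assumption).
match type of H with ?A - ?B = 0 => replace A with B by lra end.
destruct (Nat.eqb _ _); unfold Rdiv; ring.
Qed.

(** Take [d] to be the positive [r]-th root of [theta]. The derivatives of [exp (- y^r)] at 0 vanish
    except at orders [r * n], where [d ^ (r * n) = theta ^ n]. *)
Lemma periodic_stretched_exp_series (c a : nat -> R) (p r N : nat) (x : R) :
  (0 < r)%nat -> 0 <= x ->
  (forall n, c (n + S p)%nat = c n) ->
  (exists C, forall n, Rabs (c n) <= C) ->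
  (forall n, sum_f_R0 (fun m => c m * ((INR m + x) ^ n / INR (fact n))) p =
             sum_f_R0 (fun k => a k * expm1_coef (INR (S p)) (n - k)) n) ->
  exists M, forall theta, 0 < theta < 1 ->
    Rabs (Series (fun n => c n * exp (- (INR n + x) ^ r * theta))
      + sum_f_R0 (fun n => (-1) ^ n * (a (r * n)%nat * INR (fact (r * n)) / INR (fact n))
                           * theta ^ n) N)
    <= M * theta ^ S N.
Proof.
intros Hr Hx Hper HC Hrel.
destruct (periodic_series_asymptotics _ c a p (r * S N) x (stretched_exp_tower r Hr)
  Hx Hper HC Hrel) as [M HM].
(* Stopping at order [r * S N] leaves one main term too many, itself [O (theta^(N+1))]. *)
set (last := (-1) ^ S N * (a (r * S N)%nat * INR (fact (r * S N)) / INR (fact (S N)))).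
exists (M + Rabs last). intros theta Hth.
assert (Hr' : 0 < / INR r) by (apply Rinv_0_lt_compat, lt_0_INR; assumption).
set (d := Rpower theta (/ INR r)).
assert (Hd : 0 < d) by apply exp_pos.
assert (Hdr : d ^ r = theta).
{ unfold d. rewrite <- Rpower_pow by assumption. rewrite Rpower_mult, Rinv_l, Rpower_1; [reflexivity | lra|].
  apply not_0_INR. lia. }
assert (Hd1 : d < 1).
{ destruct (Rlt_dec d 1) as [|Hge]; [assumption|exfalso].
  assert (1 <= d ^ r) by (apply pow_R1_Rle; lra). lra. }
specialize (HM d (conj Hd Hd1)).
rewrite pow_mult, Hdr in HM.
rewrite (Series_ext _ (fun n => c n * exp (- (INR n + x) ^ r * theta))) in HM.
2:{ intros n. simpl Derive_n. unfold stretched_exp.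
    rewrite Rpow_mult_distr, Hdr. do 2 f_equal. ring. }
unfold tower_sum in HM. rewrite sum_multiples in HM; [|assumption|].
2:{ intros k Hk. rewrite stretched_exp_derive_0 by assumption.
    destruct (Nat.eqb_spec (k mod r) 0) as [E|E]; [|ring].
    exfalso. apply Hk. now apply Nat.Lcm0.mod_divide. }
rewrite (sum_eq _ (fun n => (-1) ^ n * (a (r * n)%nat * INR (fact (r * n)) / INR (fact n))
                           * theta ^ n)) in HM.
2:{ intros n _. rewrite stretched_exp_derive_0 by assumption.
    rewrite (Nat.mul_comm r n), Nat.Div0.mod_mul, Nat.div_mul by lia. simpl Nat.eqb. cbv iota.
    rewrite (Nat.mul_comm n r), pow_mult, Hdr. unfold Rdiv. ring. }
rewrite tech5 in HM. fold last in HM.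
assert (Ht : 0 <= theta ^ S N) by (apply pow_le; lra).
match type of HM with Rabs (?A + (?B + ?T)) <= _ =>
  replace (A + B) with ((A + (B + T)) + - T) by ring end.
eapply Rle_trans; [apply Rabs_triang|].
rewrite Rabs_Ropp, Rabs_mult, (Rabs_pos_eq (theta ^ S N)) by assumption.
rewrite Rmult_plus_distr_r. lra.
Qed.

(** * Power series and the Bernoulli coefficients *)

(** Outside the disk of convergence the terms do not tend to 0, contrary to convergence at [t]. *)
Lemma ex_pseries_CV_radius (a : nat -> R) (t : R) :
  t <> 0 -> ex_pseries a t -> Rbar_lt 0 (CV_radius a).
Proof.
intros Ht H. apply Rbar_lt_le_trans with (Rabs t); [now apply Rabs_pos_lt|].
apply Rbar_not_lt_le. intros Hlt. apply (CV_disk_outside _ _ Hlt).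
apply ex_series_lim_0. destruct H as [l Hl]. exists l. now apply is_pseries_R.
Qed.

Lemma is_pseries_exp_scaled (s t : R) :
  is_pseries (fun n => s ^ n / INR (fact n)) t (exp (s * t)).
Proof.
apply is_pseries_R.
assert (E : forall n, / INR (fact n) * (s * t) ^ n = s ^ n / INR (fact n) * t ^ n).
{ intros n. rewrite Rpow_mult_distr. unfold Rdiv. ring. }
apply is_series_ext with (1 := E).
apply is_pseries_R, is_exp_Reals.
Qed.

Lemma is_pseries_expm1 (w t : R) : is_pseries (expm1_coef w) t (exp (w * t) - 1).
Proof.
assert (H := is_pseries_exp_scaled w t). apply is_pseries_R in H.
apply is_pseries_R, is_series_decr_1.
apply (is_series_incr_1 (fun n => w ^ n / INR (fact n) * t ^ n)).
replace (plus _ _) with (exp (w * t)); [exact H|].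
unfold plus, opp; simpl. field.
Qed.

Lemma is_pseries_exp_combination (c : nat -> R) (x t : R) (p : nat) :
  is_pseries (fun n => sum_f_R0 (fun m => c m * ((INR m + x) ^ n / INR (fact n))) p) t
    (sum_f_R0 (fun m => c m * exp ((INR m + x) * t)) p).
Proof.
assert (H : forall m, is_pseries (fun n => c m * ((INR m + x) ^ n / INR (fact n))) t
  (c m * exp ((INR m + x) * t))).
{ intros m. apply (is_pseries_scal (V := R_NormedModule) (c m)); [apply Rmult_comm|].
  apply is_pseries_exp_scaled. }
induction p as [|p IH]; [apply (H 0%nat)|].
apply (is_pseries_plus (V := R_NormedModule) _ _ _ _ _ IH (H (S p))).
Qed.

(** Multiplying the generating function by [e^(wt) - 1] gives [t] times an exponential sum, and
    coefficients are compared. The vanishing of [sum c] forces [beta 0 = 0], which permits the shift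
    from [beta k] to [beta (S k)]. *)
Lemma bernoulli_coef_relation (c beta : nat -> R) (p : nat) (x rho : R) :
  0 < rho -> sum_f_R0 c p = 0 ->
  (forall t, t <> 0 -> Rabs t < rho -> is_series (fun n => beta n * t ^ n)
    (t * sum_f_R0 (fun m => c m * exp ((INR m + x) * t)) p / (exp (INR (S p) * t) - 1))) ->
  forall n, sum_f_R0 (fun m => c m * ((INR m + x) ^ n / INR (fact n))) p =
            sum_f_R0 (fun k => beta (S k) * expm1_coef (INR (S p)) (n - k)) n.
Proof.
intros Hrho Hc Hbeta.
set (w := INR (S p)) in *.
assert (Hw : 0 < w) by apply lt_0_INR, Nat.lt_0_succ.
set (W := fun n => sum_f_R0 (fun m => c m * ((INR m + x) ^ n / INR (fact n))) p).
assert (HRb : Rbar_lt 0 (CV_radius beta)).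
{ apply ex_pseries_CV_radius with (rho / 2); [lra|]. eexists. apply is_pseries_R.
  apply Hbeta; [lra|]. rewrite Rabs_pos_eq; lra. }
assert (HRe : Rbar_lt 0 (CV_radius (expm1_coef w))).
{ apply ex_pseries_CV_radius with 1; [lra|]. eexists. apply is_pseries_expm1. }
assert (HRW : Rbar_lt 0 (CV_radius (PS_incr_1 W))).
{ rewrite CV_radius_incr_1. apply ex_pseries_CV_radius with 1; [lra|].
  eexists. apply is_pseries_exp_combination. }
assert (Hrad : exists e, 0 < e < rho /\ forall t, Rabs t < e ->
  Rbar_lt (Rabs t) (CV_radius beta) /\ Rbar_lt (Rabs t) (CV_radius (expm1_coef w))).
{ assert (Hr : forall q, Rbar_lt 0 q -> exists e : R, 0 < e /\ Rbar_le e q).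
  { intros [q| |] Hq; [exists q | exists 1 | destruct Hq]; split; simpl in *; try lra; exact I. }
  destruct (Hr _ HRb) as (e1 & He1 & L1). destruct (Hr _ HRe) as (e2 & He2 & L2).
  exists (Rmin (rho / 2) (Rmin e1 e2)). split.
  - split; [repeat apply Rmin_glb_lt; lra|].
    eapply Rle_lt_trans; [apply Rmin_l | lra].
  - intros t Ht. apply Rmin_Rgt in Ht as [_ Ht]. apply Rmin_Rgt in Ht as [T1 T2].
    split; eapply Rbar_lt_le_trans; [| exact L1 | | exact L2]; simpl; assumption. }
destruct Hrad as (e & He & Hin).
assert (Hprod : forall t, Rabs t < e ->
  is_pseries (PS_mult beta (expm1_coef w)) t (PSeries (PS_incr_1 W) t)).
{ intros t Ht. destruct (Hin t Ht) as [L1 L2].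
  rewrite PSeries_incr_1, (is_pseries_unique W t _ (is_pseries_exp_combination c x t p)).
  (* The hypothesis is silent at [t = 0], but identifying coefficients requires equality on a whole
     neighbourhood; there both sides are 0. *)
  destruct (Req_dec t 0) as [->|Ht0].
  - replace (0 * _) with (PSeries beta 0 * (exp (w * 0) - 1)).
    + apply is_pseries_mult; [|apply is_pseries_expm1 | assumption | assumption].
      apply PSeries_correct. now apply CV_radius_inside.
    + rewrite !Rmult_0_r, exp_0. ring.
  - match goal with |- is_pseries _ _ ?l => replace l with
      (t * sum_f_R0 (fun m => c m * exp ((INR m + x) * t)) p / (exp (w * t) - 1)
       * (exp (w * t) - 1)) end.
    + apply is_pseries_mult; [|apply is_pseries_expm1 | assumption | assumption].
      apply is_pseries_R, Hbeta; lra.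
    + field. intros E. apply Ht0. assert (Hwt : w * t = 0) by (apply exp_inv; rewrite exp_0; lra).
      apply Rmult_integral in Hwt. lra. }
assert (HRm : Rbar_lt 0 (CV_radius (PS_mult beta (expm1_coef w)))).
{ apply ex_pseries_CV_radius with (e / 2); [lra|]. eexists. apply Hprod.
  rewrite Rabs_pos_eq; lra. }
assert (Hcoef : forall n, PS_mult beta (expm1_coef w) n = PS_incr_1 W n).
{ intros n. apply PSeries_ext_recip; [assumption | assumption |].
  exists (mkposreal e (proj1 He)). intros t Ht.
  apply is_pseries_unique, Hprod.
  unfold ball in Ht; simpl in Ht. unfold AbsRing_ball, abs, minus, plus, opp in Ht; simpl in Ht.
  now rewrite Ropp_0, Rplus_0_r in Ht. }
(* The coefficient of [t] reads [beta 0 * w = sum c = 0]. *)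
assert (Hb0 : beta 0%nat = 0).
{ assert (H1 := Hcoef 1%nat). unfold PS_mult, PS_incr_1, W in H1. simpl in H1.
  rewrite (sum_eq _ c) in H1 by (intros; field). rewrite Hc in H1.
  apply Rmult_eq_reg_r with w; lra. }
intros n. change (W n = sum_f_R0 (fun k => beta (S k) * expm1_coef w (n - k)) n).
change (W n) with (PS_incr_1 W (S n)). rewrite <- Hcoef. unfold PS_mult.
rewrite decomp_sum by lia. rewrite Hb0, Rmult_0_l, Rplus_0_l. reflexivity.
Qed.

(** * Vanishing of the character sum over a period *)

(** Summing over a list lets the residues be reordered by a [Permutation]. *)
Definition Csum (l : list C) : C := fold_right Cplus (RtoC 0) l.

Lemma Csum_permutation (l l' : list C) : Permutation l l' -> Csum l = Csum l'.
Proof.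
unfold Csum. induction 1; simpl; try congruence. ring.
Qed.

Lemma Csum_map_scale {A : Type} (z : C) (h : A -> C) (l : list A) :
  Csum (map (fun m => z * h m)%C l) = (z * Csum (map h l))%C.
Proof. induction l as [|m l IH]; simpl; [ring | rewrite IH; ring]. Qed.

Lemma Csum_seq (h : nat -> C) (n : nat) : Csum (map h (seq 0 (S n))) = sum_n h n.
Proof.
assert (Happ : forall l l', Csum (l ++ l') = (Csum l + Csum l')%C).
{ induction l as [|m l IH]; intros l'; simpl; [ring | rewrite IH; ring]. }
induction n as [|n IH].
- rewrite sum_O. simpl. ring.
- rewrite seq_S, map_app, Happ, IH, sum_Sn. simpl. unfold plus; simpl. ring.
Qed.

Lemma dirichlet_character_mod (q : nat) (chi : Z -> C) (m : Z) :
  is_dirichlet_character q chi -> chi (m mod Z.of_nat q)%Z = chi m.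
Proof.
intros (Hq & _ & Hper & _).
assert (Hk : forall k m, chi (m + Z.of_nat q * k)%Z = chi m).
{ intros k. induction k as [|k IH|k IH] using Z.peano_ind; intros n.
  - f_equal. lia.
  - rewrite <- (IH n), <- (Hper (n + Z.of_nat q * k)%Z). f_equal. lia.
  - rewrite <- (IH n), <- (Hper (n + Z.of_nat q * Z.pred k)%Z). f_equal. lia. }
rewrite <- (Hk (m / Z.of_nat q)%Z). f_equal.
rewrite (Z.div_mod m (Z.of_nat q)) at 3 by lia. lia.
Qed.

(** Otherwise [chi] would be induced by the character modulo 1; primitivity then gives [f = 1],
    every integer is coprime to [f], and [chi] is principal. *)
Lemma primitive_nonprincipal_nontrivial (f : nat) (chi : Z -> C) :
  is_primitive_character f chi -> chi <> principal_character ->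
  exists a, Z.gcd a (Z.of_nat f) = 1%Z /\ chi a <> RtoC 1.
Proof.
intros [Hchi Hprim] Hnp. apply NNPP. intros Hno. apply Hnp.
assert (Hone : forall m, Z.gcd m (Z.of_nat f) = 1%Z -> chi m = RtoC 1).
{ intros m Hm. apply NNPP. intros Hm1. apply Hno. now exists m. }
assert (Hf : 1%nat = f).
{ apply (Hprim 1%nat principal_character).
  - apply Nat.divide_1_l.
  - repeat split; try (intros; unfold principal_character; ring).
    + lia.
    + intros _. apply Z.gcd_1_r.
    + intros _. apply C1_nz.
  - exact Hone. }
apply functional_extensionality. intros m. apply Hone. rewrite <- Hf. apply Z.gcd_1_r.
Qed.

(** Multiplication by [a] coprime to [f] permutes the residues, so the sum [s] satisfies
    [s = chi a * s]; choose [a] with [chi a] different from 1. *)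
Lemma primitive_nonprincipal_sum (f : nat) (chi : Z -> C) :
  is_primitive_character f chi -> chi <> principal_character ->
  sum_n (fun m => chi (Z.of_nat m)) (f - 1) = RtoC 0.
Proof.
intros Hprim Hnp.
destruct (primitive_nonprincipal_nontrivial f chi Hprim Hnp) as (a & Ha & Ha1).
destruct Hprim as [Hchi _]. assert (Hchi' := Hchi). destruct Hchi as (Hf & Hmul & _ & _).
set (h := fun m => chi (Z.of_nat m)).
set (act := fun m => Z.to_nat ((a * Z.of_nat m) mod Z.of_nat f)).
assert (Hact : forall m, Z.of_nat (act m) = ((a * Z.of_nat m) mod Z.of_nat f)%Z).
{ intros m. apply Z2Nat.id. apply Z.mod_pos_bound. lia. }
rewrite <- Csum_seq. replace (S (f - 1)) with f by lia.
(* An injective map of the finite list of residues into itself is a permutation; injectivity is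
   Gauss's lemma, [a] being coprime to [f]. *)
assert (HP : Permutation (map act (seq 0 f)) (seq 0 f)).
{ apply NoDup_Permutation_bis.
  - apply NoDup_map_NoDup_ForallPairs; [|apply seq_NoDup].
    intros m m' Hm Hm' E. apply in_seq in Hm. apply in_seq in Hm'.
    apply (f_equal Z.of_nat) in E. rewrite !Hact in E.
    assert (Hdiv : (Z.of_nat f | Z.of_nat m - Z.of_nat m')%Z).
    { apply Z.gauss with a; [|now rewrite Z.gcd_comm].
      exists (a * Z.of_nat m / Z.of_nat f - a * Z.of_nat m' / Z.of_nat f)%Z.
      generalize (Z.div_mod (a * Z.of_nat m) (Z.of_nat f) ltac:(lia)).
      generalize (Z.div_mod (a * Z.of_nat m') (Z.of_nat f) ltac:(lia)).
      rewrite E. lia. }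
    destruct Hdiv as [k Hk]. assert (k = 0)%Z by nia. lia.
  - rewrite length_map. reflexivity.
  - intros m Hm. apply in_map_iff in Hm as (m' & <- & _). apply in_seq.
    assert (H := Z.mod_pos_bound (a * Z.of_nat m') (Z.of_nat f) ltac:(lia)).
    rewrite <- Hact in H. lia. }
assert (E : Csum (map h (seq 0 f)) = (chi a * Csum (map h (seq 0 f)))%C).
{ rewrite <- Csum_map_scale at 1.
  rewrite <- (Csum_permutation _ _ (Permutation_map h HP)), map_map. f_equal.
  apply map_ext. intros m. unfold h. rewrite Hact, dirichlet_character_mod by assumption.
  apply Hmul. }
set (s := Csum (map h (seq 0 f))) in *.
assert (Hz : ((chi a - RtoC 1) * s)%C = RtoC 0).
{ transitivity (chi a * s - s)%C; [ring|]. rewrite <- E. ring. }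
apply NNPP. intros Hs. apply (Cmult_neq_0 (chi a - RtoC 1)%C s); [|exact Hs | exact Hz].
intros H. apply Ha1. transitivity (chi a - RtoC 1 + RtoC 1)%C; [ring|]. rewrite H. ring.
Qed.

(** * Passage to real and imaginary parts, and conclusion *)

(** Apart from the values of [chi] and [B], all quantities are real, so the real estimates apply to
    each part; [pr] treats both at once. *)
Definition coordinate (pr : C -> R) : Prop := pr = Re \/ pr = Im.

Lemma coordinate_plus (pr : C -> R) (z w : C) :
  coordinate pr -> pr (z + w)%C = pr z + pr w.
Proof. intros [-> | ->]; reflexivity. Qed.

Lemma coordinate_mult_r (pr : C -> R) (z : C) (a : R) :
  coordinate pr -> pr (z * RtoC a)%C = pr z * a.
Proof. intros [-> | ->]; unfold Re, Im; simpl; ring. Qed.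

Lemma coordinate_le_Cmod (pr : C -> R) (z : C) : coordinate pr -> Rabs (pr z) <= Cmod z.
Proof.
intros [-> | ->].
- exact (Rle_trans _ _ _ (Rmax_l _ (Rabs (Im z))) (Rmax_Cmod z)).
- exact (Rle_trans _ _ _ (Rmax_r (Rabs (Re z)) _) (Rmax_Cmod z)).
Qed.

Lemma coordinate_sum (pr : C -> R) (u : nat -> C) (n : nat) :
  coordinate pr -> pr (sum_n u n) = sum_f_R0 (fun k => pr (u k)) n.
Proof.
intros H. induction n as [|n IH]; [now rewrite sum_O|].
rewrite sum_Sn, tech5, <- IH. now apply coordinate_plus.
Qed.

Lemma coordinate_is_series (pr : C -> R) (u : nat -> C) (l : C) :
  coordinate pr -> is_series (K := C_AbsRing) (V := C_NormedModule) u l ->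
  is_series (fun n => pr (u n)) (pr l).
Proof.
intros Hpr H. apply filterlim_locally. intros eps.
generalize (proj1 (filterlim_locally _ _) H eps). apply filter_imp. intros n Hn.
rewrite sum_n_Reals, <- coordinate_sum by assumption.
destruct Hpr as [-> | ->]; [exact (proj1 Hn) | exact (proj2 Hn)].
Qed.

Lemma coordinate_CSeries (pr : C -> R) (u : nat -> C) :
  coordinate pr -> pr (CSeries u) = Series (fun n => pr (u n)).
Proof. intros [-> | ->]; reflexivity. Qed.

Lemma Cexp_RtoC (t : R) : Cexp (RtoC t) = RtoC (exp t).
Proof.
unfold Cexp, Re, Im, RtoC; simpl. rewrite cos_0, sin_0. f_equal; ring.
Qed.

(** The conjugate in the generating function cancels the one in [conj_character], leaving [chi]
    itself; the other factors are real for real [x] and [t], so [pr] passes through them. *)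
Lemma bernoulli_gen_fun_coordinate (pr : C -> R) (p : nat) (chi : Z -> C) (x t : R) :
  coordinate pr -> t <> 0 ->
  pr (bernoulli_gen_fun (S p) (conj_character chi) (RtoC x) (RtoC t)) =
  t * sum_f_R0 (fun m => pr (chi (Z.of_nat m)) * exp ((INR m + x) * t)) p
    / (exp (INR (S p) * t) - 1).
Proof.
intros Hpr Ht.
assert (Hexp : exp (INR (S p) * t) - 1 <> 0).
{ intros E. apply Ht. assert (Hwt : INR (S p) * t = 0) by (apply exp_inv; rewrite exp_0; lra).
  apply Rmult_integral in Hwt. assert (0 < INR (S p)) by apply lt_0_INR, Nat.lt_0_succ. lra. }
unfold bernoulli_gen_fun. rewrite coordinate_sum by assumption.
replace (S p - 1)%nat with p by lia.
unfold Rdiv. rewrite Rmult_assoc, (Rmult_comm (sum_f_R0 _ _)), <- Rmult_assoc, scal_sum.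
apply sum_eq. intros m _.
unfold conj_character. rewrite Cconj_conj.
rewrite <- RtoC_plus, <- !RtoC_mult, !Cexp_RtoC, <- RtoC_minus.
unfold Cdiv. rewrite <- RtoC_inv, <- !Cmult_assoc, <- !RtoC_mult, coordinate_mult_r by assumption.
ring.
Qed.

Lemma G2_coordinate_asymptotics (pr : C -> R) (f : nat) (chi : Z -> C) (r : nat) (b : R)
  (B : nat -> C -> C) (N : nat) :
  coordinate pr -> is_primitive_character f chi -> chi <> principal_character ->
  (0 < r)%nat -> 0 <= b -> is_gen_bernoulli f (conj_character chi) B ->
  exists K, forall theta, 0 < theta < 1 ->
    Rabs (pr (G2 chi theta b r -
              - (RtoC (INR r) *
                 sum_n (fun n : nat =>
                   RtoC ((-1) ^ n) *
                   (B (r * n + 1)%nat (RtoC (b / INR r)) /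
                    RtoC (INR (r * n + 1) * INR (fact n))) *
                   RtoC (theta ^ n))%C N))%C)
    <= K * theta ^ (N + 1).
Proof.
intros Hpr Hprim Hnp Hr Hb HB.
assert (Hsum := primitive_nonprincipal_sum f chi Hprim Hnp).
destruct Hprim as [Hchi _].
destruct f as [|p]; [destruct Hchi; lia|].
replace (S p - 1)%nat with p in Hsum by lia.
set (x := b / INR r).
assert (Hr0 : 0 < INR r) by now apply lt_0_INR.
assert (Hx : 0 <= x) by now apply Rdiv_le_0_compat.
set (c := fun n => pr (chi (Z.of_nat n))).
(* Real or imaginary part of the coefficient of [t^n] in the generating function; the tower
   coefficients are [a k = beta (S k)]. *)
set (beta := fun n => pr (B n (RtoC x)) / INR (fact n)).
assert (Hrel : forall n,
  sum_f_R0 (fun m => c m * ((INR m + x) ^ n / INR (fact n))) p =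
  sum_f_R0 (fun k => beta (S k) * expm1_coef (INR (S p)) (n - k)) n).
{ apply (bernoulli_coef_relation c beta p x (2 * PI / INR (S p))).
  - apply Rdiv_lt_0_compat; [generalize PI_RGT_0; lra | apply lt_0_INR; lia].
  - unfold c. rewrite <- (coordinate_sum pr (fun m => chi (Z.of_nat m))), Hsum by assumption.
    destruct Hpr as [-> | ->]; reflexivity.
  - intros t Ht Htr. unfold c. rewrite <- bernoulli_gen_fun_coordinate by assumption.
    assert (Hs : is_series (K := C_AbsRing) (V := C_NormedModule)
      (fun n => (B n (RtoC x) * (Cpow (RtoC t) n / RtoC (INR (fact n))))%C)
      (bernoulli_gen_fun (S p) (conj_character chi) (RtoC x) (RtoC t))).
    { apply HB; [|now rewrite Cmod_R]. intros E. apply Ht. now apply RtoC_inj. }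
    apply (coordinate_is_series pr _ _ Hpr) in Hs.
    apply is_series_ext with (2 := Hs). intros n.
    rewrite <- RtoC_pow, <- RtoC_div by apply INR_fact_neq_0.
    rewrite coordinate_mult_r by assumption. unfold beta, Rdiv.
    match goal with |- ?u = ?v => change (@eq R u v) end. ring. }
destruct (periodic_stretched_exp_series c (fun k => beta (S k)) p r N x Hr Hx) as [M HM].
- intros n. unfold c. rewrite Nat2Z.inj_add. f_equal. apply Hchi.
- destruct (dirichlet_character_bounded _ _ Hchi) as [C HC]. exists C. intros n.
  eapply Rle_trans; [now apply coordinate_le_Cmod | apply HC].
- exact Hrel.
- exists (INR r * M). intros theta Hth. specialize (HM theta Hth).
  rewrite Nat.add_1_r, Rmult_assoc.
  assert (E : forall z w : C, (z - - w)%C = (z + w)%C) by (intros; ring).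
  unfold G2. rewrite E, <- Cmult_plus_distr_l, Cmult_comm, coordinate_mult_r by assumption.
  rewrite coordinate_plus, coordinate_CSeries, coordinate_sum by assumption.
  rewrite Rabs_mult, (Rabs_pos_eq (INR r)), Rmult_comm by lra.
  apply Rmult_le_compat_l; [lra|]. fold x.
  rewrite (Series_ext _ (fun n => c n * exp (- (INR n + x) ^ r * theta))).
  2:{ intros n. unfold G2_term, c. now apply coordinate_mult_r. }
  rewrite (sum_eq _ (fun n => (-1) ^ n *
    (beta (S (r * n)) * INR (fact (r * n)) / INR (fact n)) * theta ^ n)); [exact HM|].
  intros n _.
  assert (H1 := INR_fact_neq_0 n). assert (H2 := INR_fact_neq_0 (r * n)).
  assert (H3 : INR (S (r * n)) <> 0) by (apply not_0_INR; lia).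
  rewrite Nat.add_1_r, coordinate_mult_r, Cmult_comm, coordinate_mult_r by assumption.
  unfold Cdiv. rewrite <- RtoC_inv by (apply Rmult_integral_contrapositive; now split).
  rewrite coordinate_mult_r by assumption.
  (* The denominator [rn + 1] arises from [(rn)! / (rn + 1)!]. *)
  unfold beta. rewrite fact_simpl, mult_INR. field. now repeat split.
Qed.

Theorem theorem1p1 :
  forall (f : nat) (chi : Z -> C) (r : nat) (b : R) (B : nat -> C -> C),
    is_primitive_character f chi ->
    chi <> principal_character ->
    (0 < r)%nat ->
    0 <= b ->
    is_gen_bernoulli f (conj_character chi) B ->
    forall N : nat,
      exists K : R,
        at_right 0 (fun theta : R =>
          Cmod (G2 chi theta b r -
                - (RtoC (INR r) *
                   sum_n (fun n : nat =>
                     RtoC ((-1) ^ n) *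
                     (B (r * n + 1)%nat (RtoC (b / INR r)) /
                      RtoC (INR (r * n + 1) * INR (fact n))) *
                     RtoC (theta ^ n))%C N))%C
          <= K * theta ^ (N + 1)).
Proof.
intros f chi r b B Hprim Hnp Hr Hb HB N.
destruct (G2_coordinate_asymptotics Re f chi r b B N (or_introl eq_refl)
  Hprim Hnp Hr Hb HB) as [K1 H1].
destruct (G2_coordinate_asymptotics Im f chi r b B N (or_intror eq_refl)
  Hprim Hnp Hr Hb HB) as [K2 H2].
(* The modulus is at most [sqrt 2] times the larger of the two parts in absolute value, and both
   estimates hold for [0 < theta < 1]. *)
exists (sqrt 2 * Rmax K1 K2). exists (mkposreal 1 Rlt_0_1). intros theta Hth Hpos.
unfold ball in Hth; simpl in Hth. unfold AbsRing_ball, abs, minus, plus, opp in Hth; simpl in Hth.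
rewrite Ropp_0, Rplus_0_r, Rabs_pos_eq in Hth by lra.
specialize (H1 theta (conj Hpos Hth)). specialize (H2 theta (conj Hpos Hth)).
assert (Ht : 0 <= theta ^ (N + 1)) by (apply pow_le; lra).
eapply Rle_trans; [apply Cmod_2Rmax|]. rewrite Rmult_assoc.
apply Rmult_le_compat_l; [apply sqrt_pos|]. apply Rmax_lub.
- eapply Rle_trans; [exact H1|]. apply Rmult_le_compat_r; [assumption | apply Rmax_l].
- eapply Rle_trans; [exact H2|]. apply Rmult_le_compat_r; [assumption | apply Rmax_r].
Qed.
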